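(* Let $\overline{B}$ be an $\mathfrak{F}$-blocking set of $\Gamma'$ such that $\overline{B}\cap\Sigma=\Theta$, let $K=\mathfrak{K}(\Omega,\overline{B})$ be the cone with vertex $\Omega$ and base $\overline{B}$, and let $B=(K\setminus\Sigma)\cup\{X\}$, regarded as a set of points of $\Pi_r=PG(r,q^n)$. Then $B\cap S\neq\emptyset$ for every hyperplane $S$ of $\Pi_r$.
   Context: All dimensions are projective. Let $q$ be a prime power, $r\ge 2$, $n\geq 2$. Let $\Sigma$ be a hyperplane of $PG(rn,q)$, so $\Sigma\cong PG(rn-1,q)$, and let $\mathcal{S}$ be a Desarguesian $(n-1)$-spread of $\Sigma$: identifying $\Sigma$ with the projective space of the $\mathbb{F}_q$-vector space $\mathbb{F}_{q^n}^r$, the elements of $\mathcal{S}$ are the $(n-1)$-dimensional subspaces given by the one-dimensional $\mathbb{F}_{q^n}$-subspaces of $\mathbb{F}_{q^n}^r$. Barlotti-Cofman representation: $\Pi_r\cong PG(r,q^n)$ is the geometry whose points are the points of $PG(rn,q)\setminus\Sigma$ (affine points) together with the elements of $\mathcal{S}$, and whose lines are the $n$-dimensional subspaces of $PG(rn,q)$ meeting $\Sigma$ exactly in an element of $\mathcal{S}$, together with the lines of $PG(\mathcal{S})\cong PG(r-1,q^n)$ (the spread elements contained in the span of two distinct elements of $\mathcal{S}$), with natural incidence. The hyperplanes of $\Pi_r$ are $PG(\mathcal{S})$ (whose points are all elements of $\mathcal{S}$) and those represented by an $(r-1)n$-dimensional subspace $S_{(r-1)n}$ of $PG(rn,q)$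 not contained in $\Sigma$ such that $S_{(r-1)n}\cap\Sigma$ has dimension $(r-1)n-1$ and is a union of elements of $\mathcal{S}$; the points of such a hyperplane are the affine points in $S_{(r-1)n}$ and the spread elements contained in $S_{(r-1)n}$. Fix $X\in\mathcal{S}$ and a subspace $\Omega$ of $X$ of dimension $s\leq n-2$. Let $\Gamma$ be a subspace of $\Sigma$ with $\dim\Gamma=rn-s-2$ and $\Gamma\cap\Omega=\emptyset$, let $\Theta=\Gamma\cap X$, and let $\Gamma'$ be a subspace of $PG(rn,q)$ of dimension $rn-s-1$ with $\Gamma'\cap\Sigma=\Gamma$. $\mathfrak{F}=\{\langle S_{(r-1)n},\Omega\rangle\cap\Gamma' : S_{(r-1)n}\text{ a hyperplane of }\Pi_r\text{ not containing }X\}$; its members are $(r-1)n$-dimensional subspaces. A subset $\overline{B}$ of $\Gamma'$ is an $\mathfrak{F}$-blocking set if it meets every member of $\mathfrak{F}$. The cone is $\mathfrak{K}(\Omega,\overline{B})=\bigcup_{\overline{p}\in\overline{B}}\langle\overline{p},\Omega\rangle$. *)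

(* Defs.v *)
From HB Require Import structures.
From mathcomp Require Import all_boot all_order all_algebra all_field.
From mathcomp Require Import boolp classical_sets.
Set Implicit Arguments.
Unset Strict Implicit.
Unset Printing Implicit Defensive.
Import GRing.Theory.
Local Open Scope ring_scope.
Local Open Scope classical_set_scope.

(* PG(W) is the lattice of subspaces of W; the zero subspace is the empty
   projective subspace, of dimension -1. A point is a subspace of vector
   dimension 1, and a set of points is a set of such subspaces. *)
Definition pdim (F : fieldType) (W : vectType F) (U : {vspace W}) : int :=
  (\dim U)%:Z - 1.

Definition points (F : fieldType) (W : vectType F) (U : {vspace W}) :
    set {vspace W} :=
  [set p | pdim p = 0 /\ (p <= U)%VS].

(* {ffun 'I_r -> L} is L^r seen as a vector space over F (its canonical
   structure); multiplication by scalars of L has to be given separately. *)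
Definition lscale (F : fieldType) (L : fieldExtType F) (r : nat) (a : L)
    (v : {ffun 'I_r -> L}) : {ffun 'I_r -> L} :=
  [ffun i => a * v i].

(* phi identifies Sigma with L^r over F; the spread elements correspond to the
   one-dimensional L-subspaces L v. *)
Definition desarguesian_spread (F : fieldType) (L : fieldExtType F) (r : nat)
    (W : vectType F) (Sigma : {vspace W}) (S : set {vspace W}) : Prop :=
  exists phi : 'Hom({ffun 'I_r -> L}, W),
    [/\ lker phi = 0%VS, limg phi = Sigma &
        S = [set Y : {vspace W} | exists2 v : {ffun 'I_r -> L}, v != 0 &
               forall w : W, w \in Y <-> exists a : L, w = phi (lscale a v)]].

Section BarlottiCofman.
Variables (F : fieldType) (W : vectType F) (r n : nat).
Variables (Sigma : {vspace W}) (S : set {vspace W}).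

Definition union_of_spread_elements (U : {vspace W}) : Prop :=
  exists2 A : set {vspace W}, A `<=` S & points U = \bigcup_(Y in A) points Y.

(* The points of Pi_r, of both kinds, are represented by subspaces of W. *)
Definition bc_point : set {vspace W} :=
  (points fullv `\` points Sigma) `|` S.

(* T represents a hyperplane of Pi_r other than PG(S). *)
Definition affine_hyperplane (T : {vspace W}) : Prop :=
  [/\ pdim T = (r%:Z - 1) * n%:Z,
      ~~ (T <= Sigma)%VS,
      pdim (T :&: Sigma)%VS = (r%:Z - 1) * n%:Z - 1 &
      union_of_spread_elements (T :&: Sigma)%VS].

Definition bc_points_of (T : {vspace W}) : set {vspace W} :=
  [set P | bc_point P /\ (P <= T)%VS].

(* A hyperplane of Pi_r is given by the set of its points. *)
Definition bc_hyperplane (H : set {vspace W}) : Prop :=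
  H = S \/ exists2 T, affine_hyperplane T & H = bc_points_of T.

Definition frakF (X Omega Gamma' : {vspace W}) : set {vspace W} :=
  [set ((T + Omega) :&: Gamma')%VS |
     T in [set T | affine_hyperplane T /\ ~~ (X <= T)%VS]].

Definition frakF_blocking_set (X Omega Gamma' : {vspace W})
    (Bbar : set {vspace W}) : Prop :=
  Bbar `<=` points Gamma' /\
  forall M, frakF X Omega Gamma' M -> Bbar `&` points M !=set0.

Definition cone (Omega : {vspace W}) (Bbar : set {vspace W}) :
    set {vspace W} :=
  \bigcup_(p in Bbar) points (p + Omega)%VS.

Definition cone_bc_points (X Omega : {vspace W})
    (Bbar : set {vspace W}) : set {vspace W} :=
  (cone Omega Bbar `\` points Sigma) `|` [set X].

Lemma cone_bc_points_sub (X Omega : {vspace W}) (Bbar : set {vspace W}) :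
  S X -> cone_bc_points X Omega Bbar `<=` bc_point.
Proof.
move=> SX p [[[b _ [p0 _]] pS]|->]; last by right.
by left; split=> //; split=> //; apply: subvf.
Qed.

End BarlottiCofman.

(* Main.v *)
(* Let T represent an affine hyperplane not containing X. As T :&: Sigma is a
   union of spread elements, it is disjoint from X. A blocking point <w> with
   w = t + o, t in T and o in Omega, is never in Sigma: otherwise it would lie
   in Theta, hence t would lie in X and in T :&: Sigma, so that t = 0 and w = o
   would lie in both Gamma and Omega. So <t> is an affine point of T on the join
   of <w> and Omega. *)

Require Import Defs.
From HB Require Import structures.
From mathcomp Require Import all_boot all_order all_algebra all_field.
From mathcomp Require Import boolp classical_sets.
Set Implicit Arguments.
Unset Strict Implicit.
Unset Printing Implicit Defensive.
Import GRing.Theory.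
Local Open Scope ring_scope.
Local Open Scope classical_set_scope.

Lemma points_line (F : fieldType) (W : vectType F) (U : {vspace W}) (w : W) :
  w != 0 -> w \in U -> points U <[w]>%VS.
Proof.
by move=> w0 wU; split; [rewrite /pdim dim_vline w0 subrr | rewrite -memvE].
Qed.

Lemma points_lineP (F : fieldType) (W : vectType F) (U p : {vspace W}) :
  points U p -> exists w, [/\ w != 0, w \in U & p = <[w]>%VS].
Proof.
move=> [/eqP]; rewrite /pdim subr_eq0 eqz_nat => /eqP p1 pU.
have pE : p = <[vpick p]>%VS.
  apply/esym/eqP; rewrite eqEdim -memvE memv_pick p1 dim_vline vpick0 -dimv_eq0.
  by rewrite p1.
exists (vpick p); split=> //; last exact: (subvP pU _ (memv_pick p)).
by rewrite vpick0 -dimv_eq0 p1.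
Qed.

Lemma sub_of_points (F : fieldType) (W : vectType F) (U V : {vspace W}) :
  points U `<=` points V -> (U <= V)%VS.
Proof.
move=> UV; apply/subvP => w wU.
have [->|w0] := eqVneq w 0; first exact: mem0v.
by rewrite memvE; case: (UV _ (points_line w0 wU)).
Qed.

(** Distinct spread elements share no point because two one-dimensional [L]-subspaces with a common
    nonzero vector coincide; injectivity of [phi] carries this over to [W]. One inclusion suffices,
    the other follows by exchanging [X] and [Y]. *)
Lemma desarguesian_spread_sub (F : fieldType) (L : fieldExtType F) (r : nat)
    (W : vectType F) (Sigma : {vspace W}) (S : set {vspace W})
    (X Y : {vspace W}) (w : W) :
  desarguesian_spread L r Sigma S -> S X -> S Y ->
  w != 0 -> w \in X -> w \in Y -> (X <= Y)%VS.
Proof.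
case=> phi [/eqP kphi _ ->] [u _ XE] [v _ YE] w0.
move=> /XE[a wa] /YE[b wb].
have a0 : a != 0.
  apply: contraNneq w0 => a0; rewrite wa a0 (_ : lscale 0 u = 0) ?linear0 //.
  by apply/ffunP => i; rewrite !ffunE mul0r.
have /ffunP uv : lscale a u = lscale b v by apply: (lker0P kphi); rewrite -wa.
(* Since [a u = b v] with [a != 0], one has [c u = (c / a) (a u) = (c / a * b) v]. *)
apply/subvP => x /XE[c ->]; apply/YE; exists (c / a * b); congr (phi _).
apply/ffunP => i; move: (uv i); rewrite !ffunE -mulrA => <-.
by rewrite mulrA divfK.
Qed.

(** A nonzero vector common to [X] and [U] lies in one of the spread elements [Y] that make up [U];
    then [X <= Y <= U], against the assumption. *)
Lemma spread_disjoint (F : fieldType) (L : fieldExtType F) (r : nat)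
    (W : vectType F) (Sigma : {vspace W}) (S : set {vspace W})
    (X U : {vspace W}) :
  desarguesian_spread L r Sigma S -> S X -> union_of_spread_elements S U ->
  ~~ (X <= U)%VS -> (X :&: U = 0)%VS.
Proof.
move=> hS SX [A AS UE] XU; apply/eqP; rewrite -subv0; apply/subvP => w.
rewrite memv_cap memv0 => /andP[wX wU]; apply: contraNT XU => w0.
have [Y AY [_]] : (\bigcup_(Y in A) points Y) <[w]>%VS.
  by rewrite -UE; exact: points_line.
rewrite -memvE => wY.
apply: subv_trans (desarguesian_spread_sub hS SX (AS _ AY) w0 wX wY) _.
by apply: sub_of_points; rewrite UE => p pY; exists Y.
Qed.

Lemma desarguesian_spread_sub_space (F : fieldType) (L : fieldExtType F)
    (r : nat) (W : vectType F) (Sigma : {vspace W}) (S : set {vspace W})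
    (X : {vspace W}) :
  desarguesian_spread L r Sigma S -> S X -> (X <= Sigma)%VS.
Proof.
case=> phi [_ <- ->] [v _ XE].
by apply/subvP => w /XE[a ->]; rewrite memv_img ?memvf.
Qed.

Theorem theorem4
  (F : finFieldType) (q : nat) (hq : #|F| = q)
  (r n : nat) (hr : (2 <= r)%N) (hn : (2 <= n)%N)
  (L : fieldExtType F) (hL : \dim {:L} = n)
  (W : vectType F) (hW : pdim {:W} = (r * n)%N%:Z)
  (Sigma : {vspace W}) (hSigma : pdim Sigma = (r * n)%N%:Z - 1)
  (S : set {vspace W}) (hS : desarguesian_spread L r Sigma S)
  (X : {vspace W}) (hX : S X)
  (s : int) (hs : s <= n%:Z - 2)
  (Omega : {vspace W}) (hOmegaX : (Omega <= X)%VS) (hOmega : pdim Omega = s)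
  (Gamma : {vspace W}) (hGammaSigma : (Gamma <= Sigma)%VS)
  (hGamma : pdim Gamma = (r * n)%N%:Z - s - 2)
  (hGammaOmega : (Gamma :&: Omega)%VS = 0%VS)
  (Theta : {vspace W}) (hTheta : Theta = (Gamma :&: X)%VS)
  (Gamma' : {vspace W}) (hGamma' : pdim Gamma' = (r * n)%N%:Z - s - 1)
  (hGamma'Sigma : (Gamma' :&: Sigma)%VS = Gamma)
  (Bbar : set {vspace W})
  (hBbar : frakF_blocking_set r n Sigma S X Omega Gamma' Bbar)
  (hBbarSigma : Bbar `&` points Sigma = points Theta) :
  forall H : set {vspace W}, bc_hyperplane r n Sigma S H ->
    cone_bc_points Sigma X Omega Bbar `&` H !=set0.
Proof.
(* The hyperplane at infinity contains [X], which belongs to [B] by construction; the same witness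
   serves below for every [T] containing [X]. *)
move=> H [->|[T Thyp ->]]; first by exists X; split=> //; right.
have XSigma := desarguesian_spread_sub_space hS hX.
have [XT|XT] := boolP (X <= T)%VS.
  by exists X; split; [right | split=> //; right].
(* As [X <= Sigma], failing to lie in [T] means failing to lie in [T :&: Sigma], which is what
   [spread_disjoint] requires. *)
have XT0 : (X :&: (T :&: Sigma) = 0)%VS.
  have [_ _ _ Tunion] := Thyp.
  by apply: (spread_disjoint hS hX Tunion); rewrite subv_cap XSigma andbT.
have [_ /(_ ((T + Omega) :&: Gamma')%VS)] := hBbar.
case; first by exists T.
move=> p [Bp /points_lineP[w [w0 + pE]]]; rewrite memv_cap => /andP[].
case/memv_addP => t tT [o oOmega wE] wGamma'.
have oX := subvP hOmegaX _ oOmega; have oSigma := subvP XSigma _ oX.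
have tE : t = w - o by rewrite wE addrK.
have wSigma : w \notin Sigma.
  apply: contra (w0) => wSigma.
  have [_] : points Theta p.
    by rewrite -hBbarSigma; split=> //; rewrite pE; exact: points_line.
  rewrite hTheta pE -memvE memv_cap => /andP[wGamma wX].
  have t0 : t = 0.
    by apply/eqP; rewrite -memv0 -XT0 !memv_cap tT tE !memvB.
  by rewrite -memv0 -hGammaOmega memv_cap wGamma wE t0 add0r.
have tSigma : t \notin Sigma.
  by apply: contra wSigma => tSigma; rewrite wE rpredD.
have t0 : t != 0 by apply: contraNneq tSigma => ->; exact: mem0v.
have tnSigma : ~ points Sigma <[t]>%VS.
  by case=> _; rewrite -memvE; apply/negP.
exists <[t]>%VS; split; last first.
  split; last by rewrite -memvE.
  by left; split=> //; apply: points_line => //; exact: memvf.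
(* The vector [t = w - o] lies in [p + Omega], so [<[t]>] is on the cone over the blocking point
   [p]. *)
left; split=> //; exists p => //; apply: points_line => //.
by rewrite tE pE memv_add ?memv_line ?rpredN.
Qed.
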